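(* For any $0$-crossing family $\mathcal F$ of demand functions on $[0,1]$ (under the standing assumptions listed in the context), the Cautious Myopic (CM) policy satisfies $$\mathrm{Reg}(\mathrm{CM},\mathcal F)=O(\log^2 n).$$
   Context: **Model.** Prices lie in $[0,1]$; the horizon is $n$ rounds. A demand function is a map $d:[0,1]\to[0,1]$, with revenue function $r(x)=x\,d(x)$. In round $t$ the seller chooses a price $X_t\in[0,1]$ based on $X_1,D_1,\dots,X_{t-1},D_{t-1}$ (a policy), and observes a random demand $D_t$ with mean $d(X_t)$; demands observed at the same price are i.i.d. The random demand $D$ at any price has subgaussian norm $\|D\|_{\rm sg}=\inf\{c>0:\mathbb E[e^{D^2/c^2}]\le 2\}$ at most a constant $c_{\rm sg}$. A policy is a markdown policy if $X_{t-1}\ge X_t$ almost surely for $t=2,\dots,n$. The regret is $\mathrm{Reg}(X,d)=n\max_{p\in[0,1]}p\,d(p)-\mathbb E[\sum_{t=1}^nX_td(X_t)]$, and $\mathrm{Reg}(X,\mathcal F)=\sup_{d\in\mathcal F}\mathrm{Reg}(X,d)$ for a family $\mathcal F$. **Standing assumptions.** Each revenue function $r$ of a member of $\mathcal F$ is differentiable, has a unique maximizer $p^*$ on $[0,1]$, and $r'(p^* )=0$. **0-crossing family.** $\mathcal F$ is $0$-crossing if: (i) for every $p\in[0,1]$ the map $\Phi_p:\mathcal F\to\mathbb R$, $\Phi_p(d)=d(p)$, is injective; and (ii) there are $\Theta\subseteq\mathbb R$ and a bijection $\theta\mapsto d(\cdot;\theta)$ from $\Theta$ onto $\mathcal F$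 such that $\Theta$ is compact; $d:[0,1]\times\Theta\to\mathbb R$ is twice continuously differentiable; the map $p^*:\Theta\to[0,1]$ sending $\theta$ to the maximizer of $x\,d(x;\theta)$ is $c^*$-Lipschitz for some constant $c^*>0$; and there is a constant $c_2>0$ such that for every $p\in[0,1]$ the inverse $\Phi_p^{-1}$, defined on the range of $\Phi_p$ and taking values in $\Theta$ (identifying $\mathcal F$ with $\Theta$), is $c_2$-Lipschitz. Fix such a parametrization. **CM policy.** This is the following markdown policy. The time horizon is partitioned into phases $j=1,\dots,m$, with $m=O(\log n-\log\log n)$, where phase $j$ consists of $t_j=\lceil 9^j\log n\rceil$ rounds. Set $P_1=1$. In phase $j$, select price $P_j$ in all $t_j$ rounds; let $\bar D_j$ be the empirical mean of the demands observed in phase $j$, and put $\hat\theta_j=\Phi_{P_j}^{-1}(\bar D_j)$, $w_j=4c_2c_{\rm sg}\sqrt{\log n/t_j}$, $\tilde P_{j+1}=\max\{p^*(\theta):|\theta-\hat\theta_j|\le w_j\}$ (over $\theta\in\Theta$), and $P_{j+1}=\min\{\tilde P_{j+1},P_j\}$.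
   Formalization: When the empirical mean of a phase lies outside the range of Φ_{P_j}, where Φ_{P_j}^{-1} is undefined, the policy first replaces it by the nearest point of that range (the smaller one in a tie); the last phase is cut off at round n. *)

(* Defs.v *)
From HB Require Import structures.
From mathcomp Require Import all_boot all_order all_algebra.
From mathcomp Require Import all_classical all_reals all_analysis.
Set Implicit Arguments.
Unset Strict Implicit.
Unset Printing Implicit Defensive.
Import Order.TTheory GRing.Theory Num.Theory.
Import numFieldNormedType.Exports.
Local Open Scope classical_set_scope.
Local Open Scope ring_scope.

(* A function on [0, 1] is represented by one (arbitrary) extension to R; values
   outside [0, 1] are never used.  A family F of demand functions is thus a set
   of functions R -> R, and Leibniz equality of members of F stands for equality
   of demand functions. *)

Section demand_functions.
Variable R : realType.
Implicit Types (d : R -> R) (p : R) (F : set (R -> R)).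

Definition revenue d p : R := p * d p.

Definition maximizers d : set R :=
  [set p | p \in `[0, 1] /\ forall x, x \in `[0, 1] -> revenue d x <= revenue d p].

(* p^*; meaningful when [maximizers d] is a singleton *)
Definition pstar d : R := get (maximizers d).

Definition max_revenue d : R := sup [set revenue d p | p in `[0, 1]].

(* derivative of a function on [0, 1]: one-sided at the two endpoints *)
Definition deriv01 (f : R -> R) p (l : R) : Prop :=
  (f x - f p) / (x - p) @[x --> within `[0, 1] p^'] --> l.

Record standing_assumptions F : Prop := StandingAssumptions {
  demand_in01 : forall d, F d -> set_fun `[0, 1] `[0, 1] d ;
  revenue_differentiable : forall d p, F d -> p \in `[0, 1] ->
    exists l, deriv01 (revenue d) p l ;
  unique_maximizer : forall d, F d -> exists p, maximizers d = [set p] ;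
  revenue_stationary : forall d, F d -> deriv01 (revenue d) (pstar d) 0
}.

(* All iterated directional derivatives of order two exist and are continuous;
   on an open set U of the plane this is the C^2 property. *)
Definition C2_on (U : set (R * R)) (f : R * R -> R) : Prop :=
  forall (u v z : R * R), U z ->
    [/\ derivable f z u, derivable ('D_u f) z v
      & {for z, continuous ('D_v ('D_u f))}].

Variables (Theta : set R) (dem : R -> R -> R).

(* Phi_p^{-1}, with values in Theta; [dem theta] is d(.; theta) *)
Definition Phi_range p : set R := [set dem theta p | theta in Theta].

Definition Phi_inv p (y : R) : R :=
  get [set theta | Theta theta /\ dem theta p = y].

(* F is 0-crossing, with parametrization (Theta, dem) and Lipschitz constants
   cstar and c2.  Regularity on the (not open) set [0, 1] x Theta means
   regularity of an extension to an open neighbourhood. *)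
Record zero_crossing F (cstar c2 : R) : Prop := ZeroCrossing {
  Phi_injective : forall p, p \in `[0, 1] -> set_inj F (fun d => d p) ;
  param_bij : set_bij Theta F dem ;
  param_compact : compact Theta ;
  param_C2 : exists (U : set (R * R)) (g : R * R -> R),
    [/\ open U, `[0, 1] `*` Theta `<=` U, C2_on U g
      & forall p theta, p \in `[0, 1] -> Theta theta -> g (p, theta) = dem theta p] ;
  cstar_gt0 : 0 < cstar ;
  pstar_lipschitz : cstar.-lipschitz_Theta (fun theta => pstar (dem theta)) ;
  c2_gt0 : 0 < c2 ;
  Phi_inv_lipschitz : forall p, p \in `[0, 1] ->
    c2.-lipschitz_(Phi_range p) (Phi_inv p)
}.

End demand_functions.

Section demand_model.
Variable R : realType.

(* psi_2-norm of a distribution; +oo when no c qualifies *)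
Definition sg_norm (mu : {measure set R -> \bar R}) : \bar R :=
  ereal_inf [set c%:E | c in
    [set c : R | 0 < c /\
       (\int[mu]_y (expR (y ^+ 2 / c ^+ 2))%:E <= 2%:E)%E]].

(* [nu p] is the law of the random demand at price p *)
Definition demand_law (csg : R) (d : R -> R)
    (nu : R.-pker R ~> R) : Prop :=
  forall p, p \in `[0, 1] ->
    (\int[nu p]_y y%:E = (d p)%:E)%E /\ (sg_norm (nu p) <= csg%:E)%E.

(* A policy maps the past observations (price, demand), oldest first, to the
   next price.  Rounds are numbered from 0. *)
Definition policy := seq (R * R) -> R.

Section process.
Context {disp : measure_display} {Omega : measurableType disp}.
Variables (P : probability Omega R) (X D : nat -> {mfun Omega >-> R}).

Definition history (t : nat) (w : Omega) : seq (R * R) :=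
  [seq (X s w, D s w) | s <- iota 0 t].

(* sigma-algebra generated by X_0, D_0, ..., X_{t-1}, D_{t-1}, X_t *)
Definition past_events (t : nat) : set (set Omega) :=
  <<s [set A | exists s B, measurable B /\
        (((s <= t)%N /\ A = X s @^-1` B) \/ ((s < t)%N /\ A = D s @^-1` B))] >>.

(* X and D are the prices and the demands when [pi] is run for n rounds: given
   the past, D_t has law [nu (X_t)]. *)
Definition policy_run (n : nat) (pi : policy)
    (nu : R.-pker R ~> R) : Prop :=
  forall t, (t < n)%N ->
    (forall w, X t w = pi (history t w)) /\
    (forall A B, past_events t A -> measurable B ->
      P (A `&` D t @^-1` B) = (\int[P]_(w in A) nu (X t w) B)%E).

Definition regret (n : nat) (d : R -> R) : \bar R :=
  ((n%:R * max_revenue d)%:E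
    - 'E_P[fun w => (\sum_(t < n) X t w * d (X t w))%R])%E.

End process.

(* [P d] is the probability measure when the demand function is d *)
Definition family_regret (disp : measure_display) (Omega : measurableType disp)
    (P : (R -> R) -> probability Omega R) (X : nat -> {mfun Omega >-> R})
    (n : nat) (F : set (R -> R)) : \bar R :=
  ereal_sup [set regret (P d) X n d | d in F].

End demand_model.

Section cautious_myopic.
Variables (R : realType) (Theta : set R) (dem : R -> R -> R) (c2 csg : R).
Variable n : nat.
Implicit Type h : seq (R * R).

(* t_j = ceil (9 ^ j log n) *)
Definition phase_len (j : nat) : nat := `|Num.ceil (9 ^+ j * ln n%:R : R)|%N.

Definition phase_end (j : nat) : nat := (\sum_(1 <= i < j.+1) phase_len i)%N.

(* empirical mean of the demands in phase j *)
Definition mean_demand h (j : nat) : R :=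
  (\sum_(phase_end j.-1 <= s < phase_end j) (nth (0, 0) h s).2)
    / (phase_len j)%:R.

(* The empirical mean may fall outside the range of Phi_p, where Phi_p^{-1} is
   undefined; it is then replaced by the nearest point of that (closed) range,
   the smaller one in case of a tie.  Points of the range are unchanged. *)
Definition proj_range (p y : R) : R :=
  inf [set z | Phi_range Theta dem p z /\
               forall z', Phi_range Theta dem p z' -> `|z - y| <= `|z' - y|].

Definition theta_hat (p y : R) : R := Phi_inv Theta dem p (proj_range p y).

Definition radius (j : nat) : R :=
  4 * c2 * csg * Num.sqrt (ln n%:R / (phase_len j)%:R).

(* the supremum is a maximum: Theta is compact and contains the estimate, and
   theta |-> p^*(theta) is continuous *)
Definition cautious_price (theta0 w : R) : R :=
  sup [set pstar (dem theta) | theta in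
         [set theta | Theta theta /\ `|theta - theta0| <= w]].

(* [CM_price h k] is P_{k+1} *)
Fixpoint CM_price h (k : nat) : R :=
  if k is k'.+1 then
    Num.min
      (cautious_price (theta_hat (CM_price h k') (mean_demand h k)) (radius k))
      (CM_price h k')
  else 1.

(* number of phases completed after t rounds *)
Definition completed_phases (t : nat) : nat :=
  count (fun j => (phase_end j <= t)%N) (iota 1 t).

(* The last phase is cut off at the horizon. *)
Definition CM : policy R := fun h => CM_price h (completed_phases (size h)).

End cautious_myopic.

(* Main.v *)
(* The constants of the policy make one Chernoff bound suffice: in a phase with
   t rounds the average demand is within 2 csg sqrt(ln n / t) of its mean except
   with probability 2 / n, and projecting onto the range of Phi_p and inverting
   costs a factor 2 c2, so that the true parameter is within w_j of its estimate.
   On this event the prices stay above p^* and within 2 cstar w_j of it after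
   phase j; the revenue being quadratic at p^*, uniformly over the compact
   family, each round then loses O(ln n / t_j), hence each phase O(ln n), and
   there are at most ln n phases.  The exceptional event costs n * (2 ln n / n). *)

Require Import Defs.
From HB Require Import structures.
From mathcomp Require Import all_boot all_order all_algebra.
From mathcomp Require Import all_classical all_reals all_analysis.
From mathcomp Require Import measurable_realfun.
From mathcomp Require Import ring lra.
Set Implicit Arguments.
Unset Strict Implicit.
Unset Printing Implicit Defensive.
Import Order.TTheory GRing.Theory Num.Theory.
Import numFieldNormedType.Exports.
Local Open Scope classical_set_scope.
Local Open Scope ring_scope.

(** Prices react to past demands, so the errors within a phase need not be independent. The noise is
    therefore centred round by round at the mean demand of the price actually charged, and its
    moment generating function is bounded by conditioning on the past one round at a time. The
    conditional law is given only as an identity on past events and has to be extended to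
    nonnegative functions first. The subgaussian norm concerns D itself, not D minus its mean. The
    bound exp(l^2 csg^2) derived from it for the centred demand holds for l^2 csg^2 < 1 only; the
    choice l = sqrt(ln n / t_j) / csg is admissible because t_j >= 9^j ln n. Off the exceptional
    event everything is a deterministic statement about one sample path. The price of phase j+1
    rests on the data of phase j, so the ratio t_(j+1) / t_j, at most 10, enters the loss of each
    phase. *)

(** * Elementary inequalities for the exponential *)

Section exponential_inequalities.
Variable R : realType.
Implicit Types x b z : R.

(** For x <= 0, multiply by 1 - x: the left side becomes at most 1 and the right side is 1 - x^3.
    For 0 < x <= 1, the quotient of the right side by exp is 1 at 0 and has derivative y (1 - y)
    exp(-y) >= 0. *)
Lemma expR_le_sqr x : x <= 1 -> expR x <= 1 + x + x ^+ 2.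
Proof.
move=> x1; have [x0|x0] := leP x 0.
  have x10 : 0 < 1 - x by lra.
  have e0 : 0 < expR x by exact: expR_gt0.
  have eN : 1 - x <= expR (- x) by have := expR_ge1Dx (- x); lra.
  have eE : expR x * expR (- x) = 1 by rewrite -expRD subrr expR0.
  have : expR x * (1 - x) <= 1 by rewrite -[leRHS]eE ler_pM2l.
  move=> h; rewrite -(ler_pM2r x10); apply: le_trans h _.
  have -> : (1 + x + x ^+ 2) * (1 - x) = 1 - x * x ^+ 2 by ring.
  have : x * x ^+ 2 <= 0 by rewrite mulr_le0_ge0 ?sqr_ge0.
  lra.
pose f y : R := (1 + y + y ^+ 2) * expR (- y).
pose df y : R := y * (1 - y) * expR (- y).
have fdf y : is_derive y (1 : R) f (df y).
  apply: is_derive_eq; rewrite /df /GRing.scale /=.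
  ring.
have cf : {within `[0, x], continuous f}.
  apply: continuous_subspaceT => y.
  exact/differentiable_continuous/derivable1_diffP.
have [c /itvP c01] := MVT_segment (ltW x0) (fun y _ => fdf y) cf.
rewrite /f oppr0 expR0 expr0n /= !addr0 mulr1 => /eqP; rewrite subr_eq => /eqP fE.
have c1 : 0 <= 1 - c by rewrite subr_ge0 (le_trans _ x1)// c01.
have f1 : 1 <= f x.
  rewrite /f fE lerDr; apply: mulr_ge0; last exact: ltW.
  by rewrite /df !mulr_ge0 ?expR_ge0 ?c01.
move: f1; rewrite -(ler_pM2r (expR_gt0 x)) mul1r /f -mulrA -expRD addNr expR0; lra.
Qed.

Lemma expR_le_expR_sqr x : expR x <= x + expR (x ^+ 2).
Proof.
have := expR_ge1Dx (x ^+ 2) => ex2.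
have [x1|x1] := leP x 1; first by have := expR_le_sqr x1; lra.
have : expR x <= expR (x ^+ 2) by rewrite ler_expR expr2 ler_peMl; lra.
lra.
Qed.

(** The tangent to exp at b z lies below exp at the points 0 and z; averaging these two inequalities
    with weights 1 - b and b cancels the slope. *)
Lemma expR_conv b z : 0 <= b <= 1 -> expR (b * z) <= 1 - b + b * expR z.
Proof.
move=> /andP[b0 b1].
have e1 : expR (b * z) * (1 - b * z) <= 1.
  have := expR_ge1Dx (- (b * z)); rewrite -(ler_pM2l (expR_gt0 (b * z))).
  by rewrite -expRD subrr expR0.
have e2 : expR (b * z) * (1 + (z - b * z)) <= expR z.
  have := expR_ge1Dx (z - b * z); rewrite -(ler_pM2l (expR_gt0 (b * z))).
  by rewrite -expRD; congr (_ <= expR _); ring.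
have := ler_wpM2l b0 e2; have := @ler_wpM2l _ (1 - b) _ _ _ e1; lra.
Qed.

End exponential_inequalities.

(** * Moment generating function of a subgaussian law *)

Section subgaussian.
Variables (R : realType) (mu : {measure set R -> \bar R}) (m : R).
Hypothesis mu1 : mu setT = 1%E.
Hypothesis mu_mean : (\int[mu]_y y%:E = m%:E)%E.

(* Using e^x <= x + e^(x^2) on x = l y keeps the linear term exact, and e^(x^2)
   is interpolated between 1 and e^(y^2 / c^2) by convexity. *)
Lemma psi2_mgf_le (c l : R) : 0 < c -> l ^+ 2 * c ^+ 2 <= 1 ->
  (\int[mu]_y (expR (y ^+ 2 / c ^+ 2))%:E <= 2%:E)%E ->
  (\int[mu]_y (expR (l * y))%:E <= (l * m + 1 + l ^+ 2 * c ^+ 2)%:E)%E.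
Proof.
move=> c0 lc1 psi; set b := l ^+ 2 * c ^+ 2; pose E y := expR (y ^+ 2 / c ^+ 2).
have c20 : 0 < c ^+ 2 by rewrite exprn_gt0.
have b0 : 0 <= b by rewrite mulr_ge0 ?sqr_ge0.
have mE : measurable_fun setT E.
  by apply: measurableT_comp => //; apply: measurable_funM => //; exact: exprn_measurable.
have iE : mu.-integrable setT (EFin \o E).
  apply/integrableP; split; first exact/measurable_EFinP.
  under eq_integral do rewrite /= ger0_norm ?expR_ge0//.
  by rewrite (le_lt_trans psi)// ltry.
have cstE (k : R) : (\int[mu]_y k%:E = k%:E)%E.
  by have := @integral_cst _ _ _ mu _ measurableT k%:E; rewrite mu1 mule1.
have i1 (k : R) : mu.-integrable setT (EFin \o cst k).
  apply/integrableP; split; first by apply/measurable_EFinP; exact: measurable_cst.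
  by rewrite /= (cstE `|k|) ltry.
(* With u = y / c, this is |u| <= (1 + u^2) / 2 <= exp(u^2). It makes the identity integrable, so
   that the integral of the linear term can be split off. *)
have yE y : `|y| <= c * E y.
  rewrite -ler_pdivrMl//.
  have -> : c^-1 * `|y| = `|y / c| by rewrite normrM normfV (gtr0_norm c0) mulrC.
  have := expR_ge1Dx (y ^+ 2 / c ^+ 2); rewrite -/(E y) -expr_div_n.
  have : 0 <= (`|y / c| - 1) ^+ 2 by exact: sqr_ge0.
  rewrite sqrrB1 real_normK ?num_real//.
  have : 0 <= (y / c) ^+ 2 by exact: sqr_ge0.
  have : 0 <= `|y / c| by [].
  by move: (`|y / c|) ((y / c) ^+ 2) => u v; lra.
have iy : mu.-integrable setT (EFin : R -> \bar R).
  apply: (@le_integrable _ _ _ mu _ measurableT _ (fun y => c%:E * (EFin \o E) y)%E).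
  - exact/measurable_EFinP.
  - by move=> y _; rewrite /= lee_fin normrM (gtr0_norm c0) (ger0_norm (expR_ge0 _)).
  - exact: integrableZl.
have pointwise y : expR (l * y) <= l * y + (1 - b) + b * E y.
  rewrite (le_trans (expR_le_expR_sqr _))//.
  have -> : (l * y) ^+ 2 = b * (y ^+ 2 / c ^+ 2).
    by rewrite exprMn /b; field; rewrite gt_eqF.
  by have /= := @expR_conv _ b (y ^+ 2 / c ^+ 2); rewrite b0 lc1 => /(_ isT); rewrite -/(E y); lra.
have ily : mu.-integrable setT (fun y => l%:E * y%:E)%E by exact: integrableZl.
have ibE : mu.-integrable setT (fun y => b%:E * (E y)%:E)%E by exact: integrableZl.
pose g y : \bar R := ((l%:E * y%:E + (1 - b)%:E) + b%:E * (E y)%:E)%E.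
apply: (@le_trans _ _ (\int[mu]_y g y)%E).
  apply: ge0_le_integral => //.
  - by apply/measurable_EFinP; apply: measurableT_comp => //; exact: measurable_funM.
  - by apply: emeasurable_funD; [apply: emeasurable_funD|] => //;
      exact: (measurable_int mu).
  - by move=> y _; rewrite /g -!EFinM -!EFinD lee_fin.
have -> : (\int[mu]_y g y = l%:E * m%:E + (1 - b)%:E + b%:E * \int[mu]_y (E y)%:E)%E.
  rewrite /g (integralD measurableT (integrableD measurableT ily (i1 _)) ibE).
  by rewrite (integralD measurableT ily (i1 _)) cstE !integralZl// mu_mean.
rewrite -EFinM.
apply: (@le_trans _ _ ((l * m)%:E + (1 - b)%:E + b%:E * 2%:E)%E).
  by rewrite leeD2l// lee_wpmul2l// lee_fin.
by rewrite -!EFinM -!EFinD lee_fin; lra.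
Qed.

(* The infimum defining [sg_norm] need not be attained, hence the strict
   inequality, which leaves room for some c' slightly above c. *)
Lemma sg_norm_mgf_le (c l : R) : 0 < c -> (sg_norm mu <= c%:E)%E ->
  l ^+ 2 * c ^+ 2 < 1 ->
  (\int[mu]_y (expR (l * y))%:E <= (expR (l * m + l ^+ 2 * c ^+ 2))%:E)%E.
Proof.
move=> c0 mu_sg lc1; apply: (@le_trans _ _ (l * m + 1 + l ^+ 2 * c ^+ 2)%:E); last first.
  by rewrite lee_fin (le_trans _ (expR_ge1Dx _))//; lra.
apply/lee_addgt0Pr => e e0; set b := l ^+ 2 * c ^+ 2 in lc1 *.
have l20 : 0 <= l ^+ 2 by exact: sqr_ge0.
(* Replacing c^2 by c^2 + eta raises l^2 c^2 by at most min(e, 1 - b): the bound grows by at most e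
   and the constraint l^2 c'^2 <= 1 survives. The +1 covers l = 0. *)
pose eta := Num.min e (1 - b) / (l ^+ 2 + 1).
have eta0 : 0 < eta by rewrite divr_gt0 ?lt_min ?e0/=; lra.
have leta : l ^+ 2 * eta <= Num.min e (1 - b).
  rewrite /eta mulrCA ler_piMr//; first by rewrite le_min (ltW e0)/=; lra.
  by rewrite ler_pdivrMr; lra.
have c2eta0 : 0 < c ^+ 2 + eta by rewrite ltr_wpDl ?sqr_ge0.
have c2eta := ltW c2eta0.
have : (sg_norm mu < (Num.sqrt (c ^+ 2 + eta))%:E)%E.
  rewrite (le_lt_trans mu_sg)// lte_fin -[ltLHS](gtr0_norm c0) -sqrtr_sqr ltr_sqrt//.
  by rewrite ltrDl.
move=> /ereal_inf_lt[_ [c' /= [c'0 psi] <-]]; rewrite lte_fin => c'lt.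
have c'2 : c' ^+ 2 <= c ^+ 2 + eta.
  by rewrite -(sqr_sqrtr c2eta) lerXn2r ?nnegrE ?sqrtr_ge0// ltW.
have lc' : l ^+ 2 * c' ^+ 2 <= b + Num.min e (1 - b).
  by rewrite (le_trans (ler_wpM2l l20 c'2))// mulrDr lerD2l.
have me : Num.min e (1 - b) <= e by rewrite ge_min lexx.
have mb : Num.min e (1 - b) <= 1 - b by rewrite ge_min lexx orbT.
apply: (le_trans (@psi2_mgf_le c' l c'0 _ psi)); first by lra.
by rewrite -EFinD lee_fin; lra.
Qed.

End subgaussian.

(** * Induction over nonnegative measurable functions *)

Section nonneg_measurable_induction.
Context d (T : measurableType d) (R : realType).
Variable Q : (T -> \bar R) -> Prop.
Hypothesis Q_indic : forall A, measurable A -> Q (fun x => (\1_A x)%:E).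
Hypothesis Q_scale : forall (r : R) f, 0 <= r -> measurable_fun setT f ->
  (forall x, 0 <= f x)%E -> Q f -> Q (fun x => r%:E * f x)%E.
Hypothesis Q_add : forall f g, measurable_fun setT f -> measurable_fun setT g ->
  (forall x, 0 <= f x)%E -> (forall x, 0 <= g x)%E ->
  Q f -> Q g -> Q (fun x => f x + g x)%E.
Hypothesis Q_lim : forall u : (T -> \bar R)^nat,
  (forall n, measurable_fun setT (u n)) -> (forall n x, 0 <= u n x)%E ->
  (forall x, nondecreasing_seq (u ^~ x)) -> (forall n, Q (u n)) ->
  Q (fun x => limn (u ^~ x)).

Import HBNNSimple.

(** Every such f is an increasing limit of simple functions. The principle serves twice below: over
    the real line for functions of the demand, and over the sub-sigma-algebra of the past. *)
Lemma nonneg_measurable_ind f : measurable_fun setT f -> (forall x, 0 <= f x)%E -> Q f.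
Proof.
move=> mf f0; pose u := nnsfun_approx measurableT mf.
have -> : f = (fun x => limn (fun n => (u n x)%:E)).
  by apply/funext => x; apply/esym/cvg_lim => //; exact: cvg_nnsfun_approx.
apply: (Q_lim (u := fun n x => (u n x)%:E)).
- by move=> n; exact/measurable_EFinP.
- by move=> n x; rewrite lee_fin.
- by move=> x a b ab; rewrite lee_fin; exact/lefP/nd_nnsfun_approx.
move=> n; move: (u n) => {u} h.
(* Truncating the coefficients at 0 makes every partial sum nonnegative, so the induction can run
   over an arbitrary list. Nothing changes for the range of h, whose negative values have empty
   preimage. *)
pose g (s : seq R) x : \bar R := (\sum_(y <- s) (Num.max 0 y)%:E * (\1_(h @^-1` [set y]) x)%:E)%E.
have mterm y : measurable_fun setT (fun x => (\1_(h @^-1` [set y]) x)%:E : \bar R).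
  by apply/measurable_EFinP; exact: measurable_indic.
have m0 (y : R) : 0 <= Num.max 0 y by rewrite le_max lexx.
have term0 y x : (0 <= (Num.max 0 y)%:E * (\1_(h @^-1` [set y]) x)%:E)%E.
  by rewrite mule_ge0// lee_fin.
have Qg s : [/\ measurable_fun setT (g s), forall x, (0 <= g s x)%E & Q (g s)].
  elim: s => [|y s [mg g0 qg]].
    have -> : g [::] = (fun x => (\1_set0 x)%:E).
      by apply/funext => x; rewrite /g big_nil indic0.
    split; first exact/measurable_EFinP/measurable_indic.
      by move=> x; rewrite lee_fin.
    by apply: Q_indic.
  have -> : g (y :: s) = (fun x => (Num.max 0 y)%:E * (\1_(h @^-1` [set y]) x)%:E + g s x)%E.
    by apply/funext => x; rewrite /g big_cons.
  have mty : measurable_fun setT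
      (fun x => (Num.max 0 y)%:E * (\1_(h @^-1` [set y]) x)%:E : \bar R)%E.
    exact: measurable_funeM.
  split; first exact: emeasurable_funD.
    by move=> x; rewrite adde_ge0.
  apply: Q_add => //; apply: Q_scale => //.
  by apply: Q_indic.
pose s := finmap.enum_fset (fset_set (range h)).
have -> : (fun x => (h x)%:E) = g s; last by have [] := Qg s.
apply/funext => x; rewrite fimfunE fsbig_finite//= -sumEFin /g.
apply: eq_bigr => y _; rewrite EFinM; have [y0|y0] := leP 0 y; first by [].
by rewrite preimage_nnfun0// indic0 !mule0.
Qed.

End nonneg_measurable_induction.

(** * Conditioning on the past *)

Section conditional_law.
Context disp (Omega : measurableType disp) (R : realType).
Variables (P : probability Omega R) (G : set (set Omega)).
Variables (X D : {mfun Omega >-> R}) (nu : R.-pker R ~> R).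
Local Notation past := (g_sigma_algebraType G).
Hypothesis past_measurable : forall A, <<s G >> A -> measurable A.
Hypothesis D_law : forall A B, <<s G >> A -> measurable B ->
  P (A `&` D @^-1` B) = (\int[P]_(w in A) nu (X w) B)%E.

Lemma past_measurable_fun d (T : measurableType d) (f : Omega -> T) :
  measurable_fun setT (f : past -> T) -> measurable_fun setT f.
Proof.
move=> mf _ B mB; apply: past_measurable.
by have := mf measurableT B mB.
Qed.

Let mX : measurable_fun setT X. Proof. exact: measurable_funP. Qed.
Let mD : measurable_fun setT D. Proof. exact: measurable_funP. Qed.

Let measurable_kernel_integral (h : R -> \bar R) : measurable_fun setT h ->
  (forall y, 0 <= h y)%E ->
  measurable_fun setT (fun w => \int[nu (X w)]_y h y)%E.
Proof.
move=> mh h0; apply: (measurable_fun_integral_kernel (l := fun w => nu (X w))) => // U mU.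
exact: (measurableT_comp (measurable_kernel nu U mU) mX).
Qed.

Lemma integral_conditional_law A (h : R -> \bar R) : <<s G >> A ->
  measurable_fun setT h -> (forall y, 0 <= h y)%E ->
  (\int[P]_(w in A) h (D w) = \int[P]_(w in A) \int[nu (X w)]_y h y)%E.
Proof.
move=> GA; have mA := past_measurable GA; move: h.
have mhD (h : R -> \bar R) : measurable_fun setT h -> measurable_fun A (h \o D).
  by move=> mh; apply: measurable_funTS; exact: measurableT_comp.
have mhX (h : R -> \bar R) : measurable_fun setT h -> (forall y, 0 <= h y)%E ->
    measurable_fun A (fun w => \int[nu (X w)]_y h y)%E.
  by move=> mh h0; apply: measurable_funTS; exact: measurable_kernel_integral.
apply: nonneg_measurable_ind => //.
- move=> B mB; under [in RHS]eq_integral do rewrite integral_indic// setIT.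
  rewrite -D_law// setIC -integral_indic//.
  by rewrite -[X in measurable X]setTI; exact: mD.
- move=> r h r0 mh h0 hE.
  under [in RHS]eq_integral do rewrite ge0_integralZl//.
  rewrite [RHS]ge0_integralZl//; first (by rewrite -hE ge0_integralZl//; exact: mhD).
    exact: mhX.
  by move=> w _; exact: integral_ge0.
- move=> f g mf mg f0 g0 fE gE.
  under [in RHS]eq_integral do rewrite ge0_integralD//.
  rewrite [RHS]ge0_integralD//;
    first (by rewrite -fE -gE ge0_integralD//; exact: mhD).
  + by move=> w _; exact: integral_ge0.
  + exact: mhX.
  + by move=> w _; exact: integral_ge0.
  + exact: mhX.
- move=> u mu u0 ndu uE.
  rewrite [LHS]monotone_convergence//; last by move=> n; exact: mhD.
  under [in RHS]eq_integral.
    move=> w _; rewrite monotone_convergence//.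
    over.
  rewrite [RHS]monotone_convergence//.
  + by congr (limn _); apply/funext => n; exact: uE.
  + by move=> n; exact: mhX.
  + by move=> n w _; exact: integral_ge0.
  + by move=> w _ a b ab; apply: ge0_le_integral => // y _; exact: ndu.
Qed.

(** This replaces conditional expectations: a factor f known from the past is kept while h(D) is
    traded for a bound k on its conditional mean. For f the indicator of a past event it follows
    from [integral_conditional_law]; the induction principle over the past does the rest. *)
Lemma conditional_expectation_le (h : R -> R) (k : Omega -> R) (f : Omega -> \bar R) :
  measurable_fun setT h -> (forall y, 0 <= h y) ->
  measurable_fun setT k -> (forall w, 0 <= k w) ->
  (forall w, \int[nu (X w)]_y (h y)%:E <= (k w)%:E)%E ->
  measurable_fun setT (f : past -> \bar R) -> (forall w, 0 <= f w)%E ->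
  (\int[P]_w ((h (D w))%:E * f w) <= \int[P]_w ((k w)%:E * f w))%E.
Proof.
move=> mh h0 mk k0 hk.
have mhD : measurable_fun setT (EFin \o (h \o D)).
  by apply/measurable_EFinP; exact: measurableT_comp.
have mkE : measurable_fun setT (EFin \o k) by exact/measurable_EFinP.
have lim_le (l : Omega -> R) (u : (Omega -> \bar R)^nat) :
    measurable_fun setT l -> (forall w, 0 <= l w) ->
    (forall n, measurable_fun setT (u n)) -> (forall n w, 0 <= u n w)%E ->
    (forall w, nondecreasing_seq (u ^~ w)) ->
    nondecreasing_seq (fun n => \int[P]_w ((l w)%:E * u n w))%E /\
    (\int[P]_w ((l w)%:E * limn (u ^~ w)) = limn (fun n => \int[P]_w ((l w)%:E * u n w)))%E.
  move=> ml l0 mu u0 ndu.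
  have mlu n : measurable_fun setT (fun w => (l w)%:E * u n w)%E.
    by apply: emeasurable_funM => //; exact/measurable_EFinP.
  have lu0 n w : (0 <= (l w)%:E * u n w)%E by rewrite mule_ge0// lee_fin.
  have ndlu w : nondecreasing_seq (fun n => (l w)%:E * u n w)%E.
    by move=> a b ab; rewrite lee_wpmul2l ?lee_fin//; exact: ndu.
  split; first by move=> a b ab; apply: ge0_le_integral => // w _; exact: ndlu.
  rewrite -monotone_convergence//; apply: eq_integral => w _.
  by rewrite limeMl//; exact: ereal_nondecreasing_is_cvgn.
move: f; pose Q (f : past -> \bar R) :=
  (\int[P]_w ((h (D w))%:E * f w) <= \int[P]_w ((k w)%:E * f w))%E.
apply: (nonneg_measurable_ind (T := past) (Q := Q)); rewrite /Q.
- move=> A GA; have mA := past_measurable GA.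
  have patchE (g : Omega -> \bar R) :
      (\int[P]_w (g w * (\1_A w)%:E) = \int[P]_(w in A) g w)%E.
    by rewrite [RHS]integral_mkcond epatch_indic.
  rewrite !patchE (integral_conditional_law (h := EFin \o h))//; last exact/measurable_EFinP.
  apply: ge0_le_integral => //.
  + by move=> w _; apply: integral_ge0 => y _; rewrite lee_fin.
  + apply: measurable_funTS; apply: measurable_kernel_integral; last by move=> y; rewrite lee_fin.
    exact/measurable_EFinP.
  + exact: measurable_funTS.
- move=> r f r0 mf f0 fle; have mf' := past_measurable_fun mf.
  under eq_integral do rewrite muleCA.
  under [leRHS]eq_integral do rewrite muleCA.
  rewrite !ge0_integralZl//; first by rewrite lee_wpmul2l// lee_fin.
  + exact: emeasurable_funM.
  + by move=> w _; rewrite mule_ge0// lee_fin.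
  + exact: emeasurable_funM.
  + by move=> w _; rewrite mule_ge0// lee_fin.
- move=> f g mf mg f0 g0 fle gle.
  have mf' := past_measurable_fun mf; have mg' := past_measurable_fun mg.
  under eq_integral do rewrite ge0_muleDr//.
  under [leRHS]eq_integral do rewrite ge0_muleDr//.
  rewrite !ge0_integralD//; first exact: leeD.
  all: try by move=> w _; rewrite mule_ge0// lee_fin.
  1-4: exact: emeasurable_funM.
- move=> u mu u0 ndu ule.
  have mu' n := past_measurable_fun (mu n).
  have [nd1 ->] := lim_le _ u (measurableT_comp mh mD) (fun w => h0 (D w)) mu' u0 ndu.
  have [nd2 ->] := lim_le _ u mk k0 mu' u0 ndu.
  apply: lee_lim; [exact: ereal_nondecreasing_is_cvgn..|].
  exact: nearW.
Qed.

End conditional_law.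

(** * Deviation of the demand noise over consecutive rounds *)

Section deviation.
Context disp (Omega : measurableType disp) (R : realType).
Variables (P : probability Omega R) (X D : nat -> {mfun Omega >-> R}).
Variables (nu : R.-pker R ~> R) (n : nat) (pi : policy R) (dm : R -> R) (c : R).
Hypothesis c0 : 0 < c.
Hypothesis mdm : measurable_fun setT dm.
Hypothesis run : policy_run P X D n pi nu.
Hypothesis X01 : forall t w, (t < n)%N -> X t w \in `[0, 1].
Hypothesis nu_mean : forall p, p \in `[0, 1] -> (\int[nu p]_y y%:E = (dm p)%:E)%E.
Hypothesis nu_sg : forall p, p \in `[0, 1] -> (sg_norm (nu p) <= c%:E)%E.

(** Centring at the random price [X s] makes the summands martingale differences although the prices
    depend on earlier demands. *)
Definition noise (a b : nat) (w : Omega) : R := \sum_(a <= s < b) (D s w - dm (X s w)).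

Let gens t : set (set Omega) := [set A | exists s B, measurable B /\
  (((s <= t)%N /\ A = X s @^-1` B) \/ ((s < t)%N /\ A = D s @^-1` B))].

Lemma past_events_measurable t A : past_events X D t A -> measurable A.
Proof.
apply: smallest_sub; first exact: sigma_algebra_measurable.
move=> _ [s [B [mB [[_ ->]|[_ ->]]]]]; rewrite -[X in measurable X]setTI.
- exact: (measurable_funP (X s)).
- exact: (measurable_funP (D s)).
Qed.

Let past_X t s : (s <= t)%N -> measurable_fun setT (X s : g_sigma_algebraType (gens t) -> R).
Proof.
move=> st _ B mB; rewrite setTI; apply: sub_sigma_algebra.
by exists s, B; split => //; left.
Qed.

Let past_D t s : (s < t)%N -> measurable_fun setT (D s : g_sigma_algebraType (gens t) -> R).
Proof.
move=> st _ B mB; rewrite setTI; apply: sub_sigma_algebra.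
by exists s, B; split => //; right.
Qed.

Let past_noise t a : measurable_fun setT (noise a t : g_sigma_algebraType (gens t) -> R).
Proof.
rewrite /noise; under eq_fun do rewrite big_nat_cond big_mkcond.
apply: measurable_sum => s; case: (boolP ((a <= s < t)%N && true)) => [|_]; last exact: measurable_cst.
move=> /andP[/andP[_ st] _].
apply: measurable_funB; first exact: past_D.
exact: (measurableT_comp mdm (past_X (ltnW st))).
Qed.

Lemma measurable_noise a b : measurable_fun setT (noise a b).
Proof. exact: (@past_measurable_fun _ _ (gens b) (@past_events_measurable b) _ _ _ (@past_noise b a)). Qed.

(** Induction on the number of rounds: given the past, the last round contributes a factor at most
    exp(l^2 c^2). *)
Lemma noise_mgf_le a k l : (a + k <= n)%N -> l ^+ 2 * c ^+ 2 < 1 ->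
  (\int[P]_w (expR (l * noise a (a + k) w))%:E <= (expR (k%:R * (l ^+ 2 * c ^+ 2)))%:E)%E.
Proof.
move=> + lc1; set b := l ^+ 2 * c ^+ 2; elim: k => [_|k IH akn].
  under eq_integral do rewrite /noise addn0 big_geq// mulr0.
  rewrite -[X in (X <= _)%E]/(\int[P]_w (cst (expR 0)%:E w))%E integral_cst//.
  by rewrite [X in (_ * X)%E](@probability_setT _ _ _ P) mule1 lee_fin mul0r.
pose t := (a + k)%N; have tn : (t < n)%N by rewrite -addnS.
have [_ law] := run tn.
have past_meas := @past_events_measurable t.
(* The past of round t includes [X t], so the centring term of that round may be moved into the
   known factor; only exp(l D_t) remains to be integrated against the kernel. *)
pose f w : R := expR (l * noise a t w - l * dm (X t w)).
have mf : measurable_fun setT (f : g_sigma_algebraType (gens t) -> R).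
  apply: measurableT_comp; first exact: measurable_expR.
  apply: measurable_funB; apply: measurable_funM.
  - exact: measurable_cst.
  - exact: (@past_noise t a).
  - exact: measurable_cst.
  - exact: (measurableT_comp mdm (past_X (leqnn t))).
have mdmX : measurable_fun setT (fun w => dm (X t w)) by exact: measurableT_comp.
have := @conditional_expectation_le _ _ _ P (gens t) (X t) (D t) nu past_meas law
  (fun y => expR (l * y)) (fun w => expR (l * dm (X t w) + b)) (EFin \o f).
have -> : (\int[P]_w ((expR (l * D t w))%:E * (EFin \o f) w) =
    \int[P]_w (expR (l * noise a (a + k.+1) w))%:E)%E.
  apply: eq_integral => w _; rewrite /= -EFinM -expRD; congr (expR _)%:E.
  by rewrite addnS /noise big_nat_recr ?leq_addr//= -/(noise a t w); ring.
have -> : (\int[P]_w ((expR (l * dm (X t w) + b))%:E * (EFin \o f) w) =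
    (expR b)%:E * \int[P]_w (expR (l * noise a (a + k) w))%:E)%E.
  rewrite -ge0_integralZl//; last first.
    apply/measurable_EFinP; apply: measurableT_comp => //.
    by apply: measurable_funM => //; exact: measurable_noise.
  apply: eq_integral => w _; rewrite /= -!EFinM -!expRD; congr (expR _)%:E.
  by rewrite -/t; ring.
move=> step.
apply: (@le_trans _ _ ((expR b)%:E * \int[P]_w (expR (l * noise a (a + k) w))%:E)%E).
  apply: step.
  - by apply: measurableT_comp => //; exact: measurable_funM.
  - by move=> y; exact: expR_ge0.
  - apply: measurableT_comp => //; apply: measurable_funD => //; exact: measurable_funM.
  - by move=> w; exact: expR_ge0.
  - move=> w; apply: sg_norm_mgf_le => //; [exact: prob_kernel|exact/nu_mean/X01|exact/nu_sg/X01].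
  - exact/measurable_EFinP.
  - by move=> w; rewrite lee_fin expR_ge0.
rewrite (le_trans (lee_wpmul2l _ (IH (ltnW tn))))//.
rewrite -EFinM lee_fin -expRD ler_expR mulrSr mulrDl mul1r addrC//.
Qed.

(** Chernoff for the noise and for its opposite. The bound on the moment generating function depends
    on l through l^2 alone, so both tails have the same estimate, whence the factor 2. *)
Lemma noise_deviation_le a k (l u : R) : (a + k <= n)%N -> 0 < l -> l ^+ 2 * c ^+ 2 < 1 ->
  (P [set w | (u <= `|noise a (a + k) w|)%R]
     <= (2 * expR (k%:R * (l ^+ 2 * c ^+ 2) - l * u))%:E)%E.
Proof.
move=> akn l0 lc1; have mS := measurable_noise a (a + k).
pose S : {mfun Omega >-> R} := mfun_Sub (mem_set mS).
pose SN : {mfun Omega >-> R} := mfun_Sub (mem_set (measurable_funN mS)).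
have tail (Z : {mfun Omega >-> R}) (l' : R) : l' ^+ 2 = l ^+ 2 ->
    (forall w, l * Z w = l' * noise a (a + k) w) ->
    (P [set w | (u <= Z w)%R] <= (expR (k%:R * (l ^+ 2 * c ^+ 2) - l * u))%:E)%E.
  move=> l'2 Zw; apply: (le_trans (chernoff Z u l0)).
  rewrite expRD EFinM lee_wpmul2r ?lee_fin ?expR_ge0//.
  rewrite /mmt_gen_fun unlock/=; under eq_integral do rewrite /= mulrC Zw.
  by rewrite -l'2 noise_mgf_le// l'2.
have mZ (Z : {mfun Omega >-> R}) : measurable [set w | u <= Z w].
  rewrite (_ : mkset _ = setT `&` Z @^-1` `[u, +oo[); last first.
    by rewrite setTI; apply/seteqP; split=> w /=; rewrite in_itv/= andbT.
  by apply: (measurable_funP Z) => //; exact: measurable_itv.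
have sub : [set w | u <= `|noise a (a + k) w|] `<=` [set w | u <= S w] `|` [set w | u <= SN w].
  move=> w /=; rewrite ler_normr => /orP[uS|uS]; [by left|by right].
have mnoise : measurable [set w | u <= `|noise a (a + k) w|].
  rewrite (_ : mkset _ = [set w | u <= S w] `|` [set w | u <= SN w]).
    by apply: measurableU; exact: mZ.
  by apply/seteqP; split=> // w /=; rewrite ler_normr => -[->|->]//; rewrite orbT.
have mU : measurable ([set w | u <= S w] `|` [set w | u <= SN w]).
  by apply: measurableU; exact: mZ.
apply: (le_trans (le_measure _ _ _ sub)); [by rewrite inE|by rewrite inE|].
apply: (le_trans (measureU2 _ _ _)); [exact: mZ|exact: mZ|].
rewrite mulrDl mul1r EFinD; apply: leeD.
- by apply: (tail S l).
- by apply: (tail SN (- l)) => [|w]; [rewrite sqrrN|rewrite mulrN mulNr].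
Qed.

End deviation.

(** * Derivatives on the unit interval and along slices of the plane *)

Section calculus.
Variable R : realType.

Lemma is_derive_slice1 (g : R * R -> R) (p q : R) :
  derivable g (p, q) (1, 0) ->
  is_derive p (1 : R) (fun x => g (x, q)) ('D_((1 : R), (0 : R)) g (p, q)).
Proof.
have E : (fun h : R => h^-1 *: ((g \o shift (p, q)) (h *: ((1 : R), (0 : R))) - g (p, q)))
    = (fun h : R => h^-1 *: (((fun x => g (x, q)) \o shift p) (h *: (1 : R)) - g (p, q))).
  apply/funext => h /=; congr (_ *: (g _ - _)).
  by congr pair; rewrite /= scaler0 add0r.
by move=> dg; split; rewrite /derivable /derive /= -E.
Qed.

Lemma derivable_slice2 (g : R * R -> R) (p q : R) :
  derivable g (p, q) (0, 1) -> derivable (fun y => g (p, y)) q (1 : R).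
Proof.
have E : (fun h : R => h^-1 *: ((g \o shift (p, q)) (h *: ((0 : R), (1 : R))) - g (p, q)))
    = (fun h : R => h^-1 *: (((fun y => g (p, y)) \o shift q) (h *: (1 : R)) - g (p, q))).
  apply/funext => h /=; congr (_ *: (g _ - _)).
  by congr pair; rewrite /= scaler0 add0r.
by rewrite /derivable /= -E.
Qed.

(** The points may come in either order. The bound on the distance from c to x is what allows a
    second application to produce a square in [revenue_quadratic]. *)
Lemma MVT01 (f df : R -> R) (x y : R) :
  (forall p : R, p \in `[0, 1] -> is_derive p (1 : R) f (df p)) ->
  x \in `[0, 1] -> y \in `[0, 1] ->
  exists c : R, [/\ c \in `[0, 1], `|c - x| <= `|y - x| & f y - f x = df c * (y - x)].
Proof.
move=> fdf.
have mvt (u v : R) : u <= v -> u \in `[0, 1] -> v \in `[0, 1] ->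
    exists c : R, [/\ c \in `[0, 1], u <= c, c <= v & f v - f u = df c * (v - u)].
  move=> uv; rewrite !in_itv/= => /andP[u0 _] /andP[_ v1].
  have sub (c : R) : u <= c -> c <= v -> c \in `[0, 1].
    by move=> uc cv; rewrite in_itv/= (le_trans u0)//= (le_trans cv).
  have dfuv (z : R) : z \in `]u, v[ -> is_derive z (1 : R) f (df z).
    by move=> /itvP zuv; apply: fdf; rewrite sub ?zuv.
  have cf : {within `[u, v], continuous f}.
    apply: continuous_in_subspaceT => z; rewrite inE/= => /itvP zuv.
    apply/differentiable_continuous/derivable1_diffP.
    by have [|] := fdf z; rewrite ?sub ?zuv.
  have [c] := MVT_segment uv dfuv cf.
  by move=> /itvP cuv E; exists c; split=> //; rewrite ?sub ?cuv.
have [xy|/ltW yx] := leP x y => x01 y01.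
  have [c [c01 xc cy E]] := mvt _ _ xy x01 y01; exists c; split=> //.
  by rewrite !ger0_norm ?subr_ge0//; lra.
have [c [c01 yc cx E]] := mvt _ _ yx y01 x01; exists c; split=> //; last by lra.
by rewrite !ler0_norm ?subr_le0//; lra.
Qed.

(** Links the possibly one-sided derivative of the assumptions to the two-sided one of a smooth
    extension: arbitrarily close to p there are points of the interval, and there both limits see
    the same difference quotient. *)
Lemma deriv01_unique (f : R -> R) (p l l' : R) : p \in `[0, 1] ->
  is_derive p (1 : R) f l -> deriv01 f p l' -> l = l'.
Proof.
rewrite in_itv/= => /andP[p0 p1] [df fl] fl'.
have {df}fl : h^-1 *: (f (h + p) - f p) @[h --> 0^'] --> l.
  rewrite -fl; move: df; rewrite /derivable /derive => /cvg_ex[/= v hv].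
  rewrite (cvg_lim _ hv)//; move: hv; apply: cvg_trans.
  by apply: near_eq_cvg; near=> h; rewrite /= /GRing.scale /= mulr1.
apply/eqP; rewrite -subr_eq0 -normr_le0; apply/ler_addgt0Pr => e e0.
have e20 : 0 < e / 2 by lra.
move/cvgrPdist_lt : fl => /(_ _ e20); rewrite near_withinE => -[/= d1 d10 H1].
move/cvgrPdist_lt : fl' => /(_ _ e20); rewrite !near_withinE => -[/= d2 d20 H2].
(* A step of at most 1/2 stays in [0, 1] if taken to the right when p <= 1/2 and to the left
   otherwise; halving the radii keeps it strictly inside both neighbourhoods. *)
pose h0 := Num.min (1 / 2) (Num.min d1 d2 / 2).
have m0 : 0 < Num.min d1 d2 by rewrite lt_min d10.
have h00 : 0 < h0 by rewrite lt_min !divr_gt0.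
have [h01 h0d] : h0 <= 1 / 2 /\ h0 <= Num.min d1 d2 / 2.
  by rewrite !ge_min !lexx orbT.
have [d1m d2m] : Num.min d1 d2 <= d1 /\ Num.min d1 d2 <= d2 by rewrite !ge_min !lexx orbT.
have [h [habs hp0 hp1]] : exists h : R, [/\ `|h| = h0, 0 <= h + p & h + p <= 1].
  have [ph|ph] := leP p (1 / 2); first by exists h0; rewrite gtr0_norm//; split=> //; lra.
  by exists (- h0); rewrite normrN gtr0_norm//; split=> //; lra.
have hN0 : h != 0 by rewrite -normr_gt0 habs.
have h1 : `|l - h^-1 *: (f (h + p) - f p)| < e / 2.
  by apply: H1 => //=; rewrite sub0r normrN habs; lra.
have h2 : `|l' - (f (h + p) - f p) / (h + p - p)| < e / 2.
  apply: H2 => /=; last by rewrite in_itv/= hp0.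
    by rewrite distrC addrK habs; lra.
  by rewrite -subr_eq0 addrK.
rewrite /GRing.scale/= mulrC in h1; rewrite addrK in h2; rewrite add0r.
set q := (f (h + p) - f p) / h in h1 h2.
have -> : l - l' = (l - q) - (l' - q) by ring.
by rewrite (le_trans (ler_normB _ _))//; lra.
Unshelve. all: by end_near. Qed.

Lemma bounded_on_compact (T : topologicalType) (K : set T) (f : T -> R) :
  compact K -> (forall z, K z -> {for z, continuous f}) ->
  exists2 M, 0 <= M & forall z, K z -> `|f z| <= M.
Proof.
move=> cK cf; have : compact (f @` K).
  by apply: continuous_compact => //; apply: continuous_in_subspaceT => z /[!inE]; exact: cf.
move=> /compact_bounded[M [Mr HM]]; exists (`|M| + 1); first by rewrite addr_ge0.
by move=> z Kz; apply: HM; [rewrite ltr_pwDr// ler_norm|exists z].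
Qed.

End calculus.

(** * Consequences of the 0-crossing assumptions *)

Section zero_crossing_family.
Context (R : realType) (F : set (R -> R)) (Theta : set R) (dem : R -> R -> R) (cstar c2 : R).
Hypothesis hF : standing_assumptions F.
Hypothesis h0 : zero_crossing Theta dem F cstar c2.

Lemma dem_family theta : Theta theta -> F (dem theta).
Proof. by have [+ _ _] := param_bij h0; exact. Qed.

Lemma dem01 theta p : Theta theta -> p \in `[0, 1] -> 0 <= dem theta p <= 1.
Proof.
move=> th p01; have := demand_in01 hF (dem_family th) p01.
by rewrite /= in_itv.
Qed.

Lemma pstarP theta : Theta theta -> maximizers (dem theta) (pstar (dem theta)).
Proof.
move=> th; have [p mE] := unique_maximizer hF (dem_family th).
by rewrite /pstar; apply: getPex; exists p; rewrite mE.
Qed.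

Lemma pstar01 theta : Theta theta -> pstar (dem theta) \in `[0, 1].
Proof. by move=> /pstarP[]. Qed.

Lemma max_revenueE theta : Theta theta ->
  max_revenue (dem theta) = revenue (dem theta) (pstar (dem theta)).
Proof.
move=> th; have [ps01 psmax] := pstarP th; apply/eqP; rewrite eq_le; apply/andP; split.
  apply: ge_sup; first by exists (revenue (dem theta) (pstar (dem theta))), (pstar (dem theta)).
  by move=> _ [x x01 <-]; exact: psmax.
apply: ub_le_sup; last by exists (pstar (dem theta)).
by exists (revenue (dem theta) (pstar (dem theta))) => _ [x x01 <-]; exact: psmax.
Qed.

Lemma revenue_quadratic : exists2 L, 0 <= L & forall theta p, Theta theta -> p \in `[0, 1] ->
  revenue (dem theta) (pstar (dem theta)) - revenue (dem theta) p
    <= L * (p - pstar (dem theta)) ^+ 2.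
Proof.
have [U [g [_ KU gC2 gE]]] := param_C2 h0.
have inU (p theta : R) : p \in `[0, 1] -> Theta theta -> U (p, theta).
  by move=> p01 th; apply: KU.
pose e : R * R := (1, 0).
pose K : set (R * R) := [set x : R | x \in `[0, 1]] `*` Theta.
have cK : compact K.
  by apply: compact_setX; [exact: segment_compact|exact: param_compact h0].
have [M M0 HM] : exists2 M, 0 <= M &
    forall z, K z -> `|'D_e ('D_e g) z| <= M.
  by apply: bounded_on_compact => // z /KU Uz; have [] := gC2 e e z Uz.
(* This bounds r'' = 2 d' + x d'', where |d''| <= M by compactness. As [C2_on] speaks of continuity
   for second derivatives, |d'| <= 1 + M is obtained by a mean value argument instead. *)
exists (2 * (1 + M) + M); first by lra.
move=> theta p th p01.
pose phi x := g (x, theta); pose phi1 x := 'D_e g (x, theta).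
pose phi2 x := 'D_e ('D_e g) (x, theta).
have d1 (x : R) : x \in `[0, 1] -> is_derive x (1 : R) phi (phi1 x).
  by move=> x01; apply: is_derive_slice1; have [] := gC2 e e _ (inU _ _ x01 th).
have d2 (x : R) : x \in `[0, 1] -> is_derive x (1 : R) phi1 (phi2 x).
  by move=> x01; apply: (@is_derive_slice1 _ ('D_e g)); have [] := gC2 e e _ (inU _ _ x01 th).
have phiE (x : R) : x \in `[0, 1] -> phi x = dem theta x by move=> x01; exact: gE.
have phi2M (x : R) : x \in `[0, 1] -> `|phi2 x| <= M by move=> x01; apply: HM.
have i0 : (0 : R) \in `[0, 1] by rewrite in_itv/= lexx ler01.
have i1 : (1 : R) \in `[0, 1] by rewrite in_itv/= lexx ler01.
have [xi [xi01 _]] := MVT01 d1 i0 i1.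
rewrite subr0 mulr1 !phiE// => phi1xi.
have dist01 (x y : R) : x \in `[0, 1] -> y \in `[0, 1] -> `|x - y| <= 1.
  by rewrite !in_itv/= => /andP[? ?] /andP[? ?]; rewrite ler_norml; lra.
(* dem theta takes values in [0, 1], so its slope is at most 1 at some xi. *)
have phi1M (x : R) : x \in `[0, 1] -> `|phi1 x| <= 1 + M.
  move=> x01; have [c [c01 _ E]] := MVT01 d2 xi01 x01.
  have -> : phi1 x = phi1 xi + phi2 c * (x - xi) by rewrite -E addrC subrK.
  rewrite (le_trans (ler_normD _ _))// lerD//.
    rewrite -phi1xi ler_norml; have := dem01 th i0; have := dem01 th i1; lra.
  by rewrite normrM -[leRHS]mulr1 ler_pM// ?phi2M// dist01.
pose r x := x * phi x; pose r1 x := phi x + x * phi1 x; pose r2 x := 2 * phi1 x + x * phi2 x.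
have dr1 (x : R) : x \in `[0, 1] -> is_derive x (1 : R) r (r1 x).
  move=> x01; have := d1 x x01 => dx; apply: is_derive_eq.
  by rewrite /r1 /GRing.scale/=; ring.
have dr2 (x : R) : x \in `[0, 1] -> is_derive x (1 : R) r1 (r2 x).
  move=> x01; have := d1 x x01 => dx; have := d2 x x01 => dx'; apply: is_derive_eq.
  by rewrite /r2 /GRing.scale/=; ring.
have rE (x : R) : x \in `[0, 1] -> r x = revenue (dem theta) x.
  by move=> x01; rewrite /r phiE.
have ps01 := pstar01 th; set ps := pstar (dem theta) in ps01 *.
have r1ps : r1 ps = 0.
  apply: (deriv01_unique ps01 (dr1 _ ps01)).
  have := revenue_stationary hF (dem_family th); rewrite /deriv01 -/ps.
  apply: cvg_trans; apply: near_eq_cvg; rewrite near_withinE.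
  by near=> x => x01; rewrite !rE.
have r2M (x : R) : x \in `[0, 1] -> `|r2 x| <= 2 * (1 + M) + M.
  move=> x01; rewrite (le_trans (ler_normD _ _))// lerD//.
    by rewrite normrM ger0_norm// ler_pM2l// phi1M.
  rewrite normrM -[leRHS]mul1r ler_pM ?phi2M//.
  by move: x01; rewrite in_itv/= => /andP[? ?]; rewrite ger0_norm.
rewrite -!rE//; have [c [c01 cps E]] := MVT01 dr1 ps01 p01.
have [c' [c'01 _ E']] := MVT01 dr2 ps01 c01.
have r1c : `|r1 c| <= (2 * (1 + M) + M) * `|p - ps|.
  by rewrite -[r1 c]subr0 -r1ps E' normrM ler_pM// r2M.
have -> : r ps - r p = - (r1 c * (p - ps)) by rewrite -E opprB.
rewrite (le_trans (ler_norm _))// normrN normrM.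
by rewrite -(real_normK (num_real (p - ps))) expr2 mulrA ler_wpM2r.
Unshelve. all: by end_near. Qed.

(** Outside [0, 1] a demand function is an arbitrary extension, possibly not measurable. The smooth
    extension restricted to [0, 1], and constant elsewhere, stands in for it in all integrals. *)
Lemma dem_measurable theta : Theta theta -> exists2 dm : R -> R,
  measurable_fun setT dm & forall p, p \in `[0, 1] -> dm p = dem theta p.
Proof.
move=> th; have [U [g [_ KU gC2 gE]]] := param_C2 h0.
exists ((fun p => g (p, theta)) \_ [set p : R | p \in `[0, 1]]); last first.
  by move=> p p01; rewrite patchE mem_set// gE.
apply/(measurable_restrictT _ _).1; first exact: measurable_itv.
apply: subspace_continuous_measurable_fun; first exact: measurable_itv.
apply: continuous_in_subspaceT => p; rewrite inE/= => p01.
apply/differentiable_continuous/derivable1_diffP.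
have Up : U (p, theta) by apply: KU.
have [dg _ _] := gC2 (1, 0) (0, 0) _ Up.
by have [] := is_derive_slice1 dg.
Qed.

Lemma Phi_range_compact p : p \in `[0, 1] -> compact (Phi_range Theta dem p).
Proof.
move=> p01; have [U [g [_ KU gC2 gE]]] := param_C2 h0.
have -> : Phi_range Theta dem p = (fun theta => g (p, theta)) @` Theta.
  by apply/seteqP; split=> _ [th Th <-]; exists th => //; rewrite gE.
apply: continuous_compact; last exact: param_compact h0.
apply: continuous_in_subspaceT => th; rewrite inE => Th.
apply/differentiable_continuous/derivable1_diffP.
have Up : U (p, th) by apply: KU.
have [dg _ _] := gC2 (0, 1) (0, 0) _ Up.
exact: derivable_slice2.
Qed.

(** Nearest points exist by compactness and all lie at the same distance from y, so there are at
    most two of them, and the infimum of the set is one of its elements. *)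
Lemma proj_rangeP p y theta : p \in `[0, 1] -> Theta theta ->
  Phi_range Theta dem p (proj_range Theta dem p y) /\
  `|proj_range Theta dem p y - y| <= `|dem theta p - y|.
Proof.
move=> p01 th; set A := Phi_range Theta dem p.
have cA : compact A by exact: Phi_range_compact.
have A0 : A (dem theta p) by exists theta.
pose S := [set z | A z /\ forall z', A z' -> `|z - y| <= `|z' - y|].
have [z0 [Az0 z0min]] : exists z, S z.
  have cf : {within A, continuous (fun z : R => `|z - y|)}.
    apply: continuous_subspaceT => z; apply: cvg_norm; apply: cvgB; [exact: cvg_id|exact: cvg_cst].
  have [z /set_mem Az zmin] := compact_EVT_min (ex_intro _ _ A0) cA cf.
  by exists z; split=> // z' Az'; apply: zmin; rewrite inE.
rewrite /proj_range -/A -/S.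
have Sabs z : S z -> `|z - y| = `|z0 - y|.
  by move=> [Az zmin]; apply/eqP; rewrite eq_le zmin//= z0min.
suff : S (inf S) by move=> [Ai imin]; split=> //; exact: imin.
set dlt := `|z0 - y| in Sabs.
have [Slow|Slow] := pselect (S (y - dlt)).
  have -> // : inf S = y - dlt.
  apply/eqP; rewrite eq_le; apply/andP; split.
    apply: ge_inf => //; exists (y - dlt) => z /Sabs E.
    by rewrite lerBlDr -lerBlDl -E distrC ler_norm.
  apply: lb_le_inf; first by exists (y - dlt).
  move=> z /Sabs E; by rewrite lerBlDr -lerBlDl -E distrC ler_norm.
have Sup z : S z -> z = y + dlt.
  move=> Sz; have := Sabs z Sz; have [zy|zy] := leP 0 (z - y).
    by rewrite ger0_norm// => <-; ring.
  rewrite ltr0_norm// => E; exfalso; apply: Slow.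
  by rewrite (_ : y - dlt = z)// -E; ring.
have Sz0 : S z0 by [].
have -> // : inf S = z0.
have -> : S = [set z0].
  by apply/seteqP; split=> [z Sz|z ->//]; rewrite /= (Sup z)// (Sup z0).
exact: inf1.
Qed.

(* The factor 2 is the price of projecting y onto the range of Phi_p. *)
Lemma theta_hatP p y theta : p \in `[0, 1] -> Theta theta ->
  Theta (theta_hat Theta dem p y) /\
  `|theta_hat Theta dem p y - theta| <= 2 * c2 * `|y - dem theta p|.
Proof.
move=> p01 th; have [Rp dist] := proj_rangeP y p01 th.
rewrite /theta_hat; set z := proj_range _ _ _ _ in Rp dist *.
have Phi_invP u : Phi_range Theta dem p u ->
    Theta (Phi_inv Theta dem p u) /\ dem (Phi_inv Theta dem p u) p = u.
  by move=> [t Tt tu]; apply: (@getPex _ [set t | Theta t /\ dem t p = u]); exists t.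
have [Tz zE] := Phi_invP z Rp; split=> //.
have Rd : Phi_range Theta dem p (dem theta p) by exists theta.
have [Td dE] := Phi_invP _ Rd.
(* [Phi_inv] chooses some parameter with this demand at p; injectivity of Phi_p on the family and of
   the parametrization forces it to be theta. *)
have thE : Phi_inv Theta dem p (dem theta p) = theta.
  have [_ inj _] := param_bij h0; apply: inj; rewrite ?inE//.
  by apply: (Phi_injective h0 p01); rewrite ?inE//; exact: dem_family.
have lipschitz_p := Phi_inv_lipschitz h0 p01.
have /= lip := lipschitz_p (z, dem theta p) (conj Rp Rd).
rewrite thE in lip; rewrite (le_trans lip)// [2 * c2]mulrC -mulrA.
rewrite ler_wpM2l ?(ltW (c2_gt0 h0))//.
have -> : z - dem theta p = (z - y) + (y - dem theta p) by ring.
by rewrite (le_trans (ler_normD _ _))// mulr_natl mulr2n lerD2r (le_trans dist)// distrC.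
Qed.

(** Prices must stay in [0, 1] on every path, the exceptional ones included, because the conditional
    bounds are applied at every outcome. The supremum of an empty set is 0, which also lies
    there. *)
Lemma cautious_price01 theta0 w : cautious_price Theta dem theta0 w \in `[0, 1].
Proof.
rewrite /cautious_price; set A := [set _ | _ in _].
have A01 x : A x -> 0 <= x <= 1 by move=> [t [Tt _] <-]; have := pstar01 Tt; rewrite in_itv.
have [[x Ax]|/nonemptyPn ->] := pselect (A !=set0); last by rewrite sup0 in_itv/= lexx ler01.
have A1 : ubound A 1 by move=> y /A01/andP[].
rewrite in_itv/=; apply/andP; split; last by apply: ge_sup => //; exists x.
have /andP[x0 _] := A01 x Ax.
by rewrite (le_trans x0)//; apply: ub_le_sup => //; exists 1.
Qed.

(** The true parameter is itself a candidate, which gives the lower bound; every candidate is within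
    2 w of it through theta0, which gives the upper one. *)
Lemma cautious_priceP theta0 theta w : Theta theta -> `|theta0 - theta| <= w ->
  pstar (dem theta) <= cautious_price Theta dem theta0 w <= pstar (dem theta) + 2 * cstar * w.
Proof.
move=> th dw; rewrite /cautious_price; set A := [set _ | _ in _].
have A1 x : A x -> x <= 1 by move=> [t [Tt _] <-]; have := pstar01 Tt; rewrite in_itv => /andP[].
have Ath : A (pstar (dem theta)) by exists theta => //; split=> //; rewrite distrC.
apply/andP; split; first by apply: ub_le_sup => //; exists 1.
apply: ge_sup; first by exists (pstar (dem theta)).
move=> _ [t [Tt tw] <-]; rewrite -lerBlDl (le_trans (ler_norm _))//.
have lipschitz_pstar := pstar_lipschitz h0.
have /= lip := lipschitz_pstar (t, theta) (conj Tt th).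
rewrite (le_trans lip)// [2 * cstar]mulrC -mulrA.
rewrite ler_wpM2l ?(ltW (cstar_gt0 h0))//.
have -> : t - theta = (t - theta0) + (theta0 - theta) by ring.
by rewrite (le_trans (ler_normD _ _))// mulr_natl mulr2n lerD.
Qed.

End zero_crossing_family.

(** * Arithmetic of the phases *)

Section phases.
Variables (R : realType) (n : nat).
Local Notation L := (@ln R n%:R).
Local Notation len := (phase_len R n).
Local Notation pend := (phase_end R n).
Hypothesis L1 : 1 <= L.

Let nine_ge1 j : 1 <= (9 : R) ^+ j.
Proof. by rewrite exprn_ege1// (ler_nat R 1 9). Qed.

Let L0 : 0 <= L. Proof. exact: le_trans L1. Qed.

Lemma phase_len_bounds j : 9 ^+ j * L <= (len j)%:R <= 9 ^+ j * L + 1.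
Proof.
have x0 : 0 <= 9 ^+ j * L by rewrite mulr_ge0// exprn_ge0.
rewrite /phase_len natr_absz ger0_norm; last by rewrite -(ler_int R) (le_trans x0)// ceil_ge.
by rewrite ceil_ge/=; have := ceilB1_lt (9 ^+ j * L); rewrite intrB; lra.
Qed.

Lemma phase_len_ge1 j : 1 <= (len j)%:R :> R.
Proof.
have /andP[+ _] := phase_len_bounds j; apply: le_trans.
by rewrite -[leLHS]mulr1 ler_pM.
Qed.

Lemma phase_len_gt0 j : (0 < len j)%N.
Proof. by rewrite -(ler_nat R) phase_len_ge1. Qed.

(** The ceiling adds at most 1, and 9 t + 1 <= 10 t for t >= 1. *)
Lemma phase_len_succ j : (len j.+1)%:R <= 10 * (len j)%:R :> R.
Proof.
have /andP[lo _] := phase_len_bounds j; have /andP[_ hi] := phase_len_bounds j.+1.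
have := phase_len_ge1 j.
rewrite exprS in hi; set u := 9 ^+ j * L in lo; rewrite -mulrA -/u in hi; lra.
Qed.

Lemma phase_end0 : pend 0 = 0%N.
Proof. by rewrite /phase_end big_geq. Qed.

Lemma phase_endS j : pend j.+1 = (pend j + len j.+1)%N.
Proof. by rewrite /phase_end big_nat_recr. Qed.

Lemma phase_end_lt j : (pend j < pend j.+1)%N.
Proof. by rewrite phase_endS -[X in (X < _)%N]addn0 ltn_add2l phase_len_gt0. Qed.

Lemma phase_end_le i j : (i <= j)%N -> (pend i <= pend j)%N.
Proof.
move=> /subnKC <-; elim: (j - i)%N => [|k IH]; first by rewrite addn0.
by rewrite addnS (leq_trans IH)// ltnW// phase_end_lt.
Qed.

Lemma phase_end_ge j : (j <= pend j)%N.
Proof. by elim: j => // j IH; rewrite (leq_ltn_trans IH)// phase_end_lt. Qed.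

(** Each phase has at least one round, so k <= t and the list [iota 1 t] reaches all k completed
    phases; no later index is counted. *)
Lemma completed_phasesE k t : (pend k <= t < pend k.+1)%N -> completed_phases R n t = k.
Proof.
move=> /andP[kt tk]; rewrite /completed_phases.
have le_kt : (k <= t)%N by rewrite (leq_trans (phase_end_ge k)).
rewrite -(subnKC le_kt) iotaD count_cat subnKC//.
rewrite (_ : count _ (iota 1 k) = k); last first.
  rewrite -[RHS](size_iota 1 k); apply/eqP; rewrite -all_count; apply/allP => j.
  by rewrite mem_iota add1n ltnS => /andP[_ jk]; rewrite (leq_trans (phase_end_le jk)).
rewrite (_ : count _ _ = 0%N) ?addn0//; apply/eqP; rewrite -leqn0 leqNgt -has_count.
apply/hasPn => j; rewrite mem_iota add1n => /andP[kj _].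
by rewrite -ltnNge (leq_trans tk)// phase_end_le.
Qed.

Lemma completed_phasesP t :
  (pend (completed_phases R n t) <= t < pend (completed_phases R n t).+1)%N.
Proof.
suff [k kt] : exists k, (pend k <= t < pend k.+1)%N by rewrite (completed_phasesE kt).
elim: t => [|t [k /andP[kt tk]]].
  by exists 0%N; rewrite phase_end0/= -[X in (X < _)%N]phase_end0 phase_end_lt.
have [lt|ge] := ltnP t.+1 (pend k.+1); first by exists k; rewrite (leqW kt).
exists k.+1; have -> : t.+1 = pend k.+1 by apply/eqP; rewrite eqn_leq tk.
by rewrite leqnn phase_end_lt.
Qed.

(** The k-th phase alone fits into n rounds, so e^k <= 9^k <= 9^k ln n <= n. *)
Lemma completed_phases_le t : (t <= n)%N -> (completed_phases R n t)%:R <= L.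
Proof.
move=> tn; have /andP[+ _] := completed_phasesP t; set k := completed_phases _ _ _ => kt.
(* By convention [ln] is 0 at nonpositive arguments, so [L1] forces n to be positive. *)
have n0 : 0 < n%:R :> R.
  by rewrite ltNge; apply/negP => n0; move: L1; rewrite ln0// ler10.
case: k kt => [|k] kt; first exact: L0.
rewrite -ler_expR lnK; last by rewrite posrE.
apply: (@le_trans _ _ (9 ^+ k.+1)).
  rewrite -[X in expR X]mulr1 expRM_natl ler_pXn2r ?nnegrE ?expR_ge0//.
  by have := @expR_le_sqr R 1 (lexx _); rewrite expr1n; lra.
have /andP[lo _] := phase_len_bounds k.+1.
apply: (@le_trans _ _ (len k.+1)%:R).
  by apply: le_trans lo; rewrite ler_peMr// exprn_ge0.
by rewrite ler_nat (leq_trans _ tn)// (leq_trans _ kt)// phase_endS leq_addl.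
Qed.

(** Prolonging the truncated phase to its full length only adds nonnegative terms. A round with k
    completed phases lies in phase k + 1, hence the shift between [len] and [b]. *)
Lemma phase_sum_le (b : nat -> R) K : (forall k, 0 <= b k) -> (n < pend K.+1)%N ->
  \sum_(t < n) b (completed_phases R n t) <= \sum_(k < K.+1) (len k.+1)%:R * b k.
Proof.
move=> b0 nK; rewrite -(big_mkord xpredT (fun t => b (completed_phases R n t))).
apply: (@le_trans _ _ (\sum_(0 <= t < pend K.+1) b (completed_phases R n t))).
  by rewrite [leRHS](big_cat_nat _ (ltnW nK))//= lerDl sumr_ge0.
elim: K.+1 => [|k IH]; first by rewrite phase_end0 big_geq// big_ord0.
rewrite big_ord_recr/= (big_cat_nat _ (ltnW (phase_end_lt k)))//=.
apply: lerD => //; rewrite (eq_big_nat _ _ (F2 := fun=> b k)).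
  by rewrite sumr_const_nat phase_endS addnC addnK mulr_natl.
by move=> t /completed_phasesE ->.
Qed.

End phases.

(** * Deterministic analysis of one sample path *)

Section sample_path.
Context (R : realType) (F : set (R -> R)) (Theta : set R) (dem : R -> R -> R).
Context (cstar c2 csg : R) (n : nat) (theta : R).
Hypothesis hF : standing_assumptions F.
Hypothesis h0 : zero_crossing Theta dem F cstar c2.
Hypothesis L1 : 1 <= @ln R n%:R.
Hypothesis th : Theta theta.
Local Notation L := (@ln R n%:R).
Local Notation len := (phase_len R n).
Local Notation pend := (phase_end R n).
Local Notation ps := (pstar (dem theta)).

Lemma CM_price01 h k : CM_price Theta dem c2 csg n h k \in `[0, 1].
Proof.
elim: k => [|k IH] /=; first by rewrite in_itv/= ler01 lexx.
by case: leP => _ //; exact: (cautious_price01 hF h0).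
Qed.

Lemma CM_priceS h k : CM_price Theta dem c2 csg n h k.+1 =
  Num.min (cautious_price Theta dem (theta_hat Theta dem (CM_price Theta dem c2 csg n h k)
    (mean_demand n h k.+1)) (Defs.radius c2 csg n k.+1)) (CM_price Theta dem c2 csg n h k).
Proof. by []. Qed.

Variables x y : nat -> R.
Let hist t := [seq (x s, y s) | s <- iota 0 t].
Hypothesis xE : forall t, (t < n)%N -> x t = CM Theta dem c2 csg n (hist t).

Lemma mean_demand_hist j t : (pend j <= t)%N ->
  mean_demand n (hist t) j = (\sum_(pend j.-1 <= s < pend j) y s) / (len j)%:R.
Proof.
move=> jt; rewrite /mean_demand; congr (_ / _); apply: eq_big_nat => s /andP[_ sj].
by rewrite (nth_map 0%N) ?size_iota ?nth_iota ?add0n// (leq_trans sj).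
Qed.

(** The price P_(k+1) reads only demands of the first k phases, so it is the same for all longer
    histories; hence the price is constant within a phase. *)
Lemma CM_price_hist k t t' : (pend k <= t)%N -> (pend k <= t')%N ->
  CM_price Theta dem c2 csg n (hist t) k = CM_price Theta dem c2 csg n (hist t') k.
Proof.
elim: k => // k IH kt kt'.
have le_k := ltnW (phase_end_lt L1 k).
rewrite /= (IH (leq_trans le_k kt) (leq_trans le_k kt')).
by rewrite (mean_demand_hist kt) (mean_demand_hist kt').
Qed.

Let price k := CM_price Theta dem c2 csg n (hist (pend k)) k.

Lemma path_price k t : (t < n)%N -> (pend k <= t < pend k.+1)%N -> x t = price k.
Proof.
move=> tn kt; rewrite xE// /CM size_map size_iota (completed_phasesE L1 kt).
by apply: CM_price_hist => //; have /andP[] := kt.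
Qed.

Hypothesis small_noise : forall j, (pend j.+1 <= n)%N ->
  `|\sum_(pend j <= s < pend j.+1) (y s - dem theta (x s))|
    < (len j.+1)%:R * (2 * csg * Num.sqrt (L / (len j.+1)%:R)).

(** The lower bound passes through the minimum because both the candidate and the previous price
    satisfy it; the upper bound comes from the candidate alone. The markdown constraint thus costs
    nothing. The initial price 1 has no upper bound of this kind, hence the clause 0 < k. *)
Lemma price_bounds k : (pend k <= n)%N ->
  ps <= price k /\ ((0 < k)%N -> price k <= ps + 2 * cstar * Defs.radius c2 csg n k).
Proof.
elim: k => [|k IH] kn; first by split=> //; have := pstar01 hF h0 th; rewrite in_itv => /andP[].
have lt_k := phase_end_lt L1 k.
have [psk _] := IH (ltnW (leq_trans lt_k kn)).
have step := CM_priceS (hist (pend k.+1)) k.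
rewrite (CM_price_hist (ltnW lt_k) (leqnn (pend k))) -/(price k) -/(price k.+1) in step.
rewrite step.
set ybar := mean_demand _ _ _.
have len0 : 0 < (len k.+1)%:R :> R by rewrite ltr0n phase_len_gt0.
have ybarE : (ybar - dem theta (price k)) * (len k.+1)%:R =
    \sum_(pend k <= s < pend k.+1) (y s - dem theta (x s)).
  rewrite mulrBl /ybar mean_demand_hist// divfK ?gt_eqF// sumrB; congr (_ - _).
  rewrite (eq_big_nat _ _ (F2 := fun=> dem theta (price k))).
    by rewrite sumr_const_nat (phase_endS R n k) addnC addnK mulr_natr.
  move=> s /andP[ks sk]; rewrite (@path_price k)// ?ks//.
  exact: leq_trans kn.
have dev : `|ybar - dem theta (price k)| < 2 * csg * Num.sqrt (L / (len k.+1)%:R).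
  have := small_noise kn.
  by rewrite -ybarE normrM (gtr0_norm len0) mulrC ltr_pM2l.
have [_ hat] := theta_hatP h0 ybar (CM_price01 (hist (pend k)) k) th.
have close : `|theta_hat Theta dem (price k) ybar - theta| <= Defs.radius c2 csg n k.+1.
  rewrite (le_trans hat)//.
  have -> : Defs.radius c2 csg n k.+1 = 2 * c2 * (2 * csg * Num.sqrt (L / (len k.+1)%:R)).
    by rewrite /Defs.radius; ring.
  by rewrite ler_wpM2l ?mulr_ge0 ?(ltW (c2_gt0 h0))// ltW.
have /andP[lo hi] := cautious_priceP hF h0 th close.
by split=> [|_]; [rewrite le_min lo|rewrite ge_min hi].
Qed.

Lemma path_regret_le Q : 0 <= Q ->
  (forall p, p \in `[0, 1] -> revenue (dem theta) ps - revenue (dem theta) p <= Q * (p - ps) ^+ 2) ->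
  \sum_(t < n) (revenue (dem theta) ps - x t * dem theta (x t))
    <= 10 * (1 + Q * (64 * cstar ^+ 2 * c2 ^+ 2 * csg ^+ 2)) * L ^+ 2.
Proof.
move=> Q0 quad; set A := Q * _.
have A0 : 0 <= A.
  have -> : A = Q * (64 * (cstar * c2 * csg) ^+ 2) by rewrite /A; ring.
  by apply: mulr_ge0 => //; apply: mulr_ge0 => //; exact: sqr_ge0.
have L0 : 0 <= L by exact: le_trans L1.
(* Loss per round after k phases. The price rests on phase k, so [len k] appears although the round
   is in phase k + 1. Before any data the loss is at most 1. The 64 in A is the square of 2
   (cautious price) times 4 (radius). *)
pose b k : R := if k is k'.+1 then A * (L / (len k)%:R) else 1.
have b0 k : 0 <= b k by case: k => //= k; rewrite mulr_ge0// divr_ge0.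
have loss t : (t < n)%N ->
    revenue (dem theta) ps - x t * dem theta (x t) <= b (completed_phases R n t).
  move=> tn; have kt := completed_phasesP L1 t; set k := completed_phases R n t in kt *.
  have -> := path_price tn kt; have p01 := CM_price01 (hist (pend k)) k.
  have kn : (pend k <= n)%N by have /andP[le_kt _] := kt; rewrite (leq_trans le_kt)// ltnW.
  have [lo hi] := price_bounds kn.
  case: k kt p01 kn lo hi => [|k] kt p01 kn lo hi /=.
    have := dem01 hF h0 th p01; have := dem01 hF h0 th (pstar01 hF h0 th).
    have := pstar01 hF h0 th; have : price 0 \in `[0, 1] by [].
    rewrite !in_itv/= /revenue => /andP[p0 p1] /andP[q0 q1] /andP[d0 d1] /andP[e0 e1].
    have : ps * dem theta ps <= 1 by rewrite mulr_ile1.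
    have : 0 <= price 0 * dem theta (price 0) by rewrite mulr_ge0.
    lra.
  apply: (le_trans (quad _ p01)).
  have -> : A * (L / (len k.+1)%:R) = Q * (2 * cstar * Defs.radius c2 csg n k.+1) ^+ 2.
    rewrite /A /Defs.radius !exprMn sqr_sqrtr ?divr_ge0//; ring.
  have {}hi := hi isT.
  rewrite ler_wpM2l// lerXn2r ?nnegrE ?subr_ge0//; last by rewrite lerBlDl.
  by rewrite -(lerD2l ps) addr0 (le_trans lo).
apply: (@le_trans _ _ (\sum_(t < n) b (completed_phases R n t))).
  by apply: ler_sum => t _; exact: loss.
set K := completed_phases R n n.
have /andP[_ nK] := completed_phasesP L1 n.
rewrite (le_trans (phase_sum_le L1 b0 nK))// -/K big_ord_recl/= mulr1.
have KL : K%:R <= L by exact: completed_phases_le.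
(* The first phase has at most 9 L + 1 <= 10 L rounds; in later phases the factor 10 is the ratio of
   consecutive lengths. *)
apply: (@le_trans _ _ (10 * L + \sum_(i < K) 10 * A * L)).
  apply: lerD.
    have /andP[_ len1] := phase_len_bounds L1 1.
    move: len1 (L1); rewrite expr1; move: (_%:R) (ln _) => u v; lra.
  apply: ler_sum => i _; rewrite /bump/= add1n.
  have len0 : 0 < (len i.+1)%:R :> R by rewrite ltr0n phase_len_gt0.
  have := phase_len_succ L1 i.+1; rewrite -ler_pdivrMr// => ratio.
  have -> : (len i.+2)%:R * (A * (L / (len i.+1)%:R)) = (len i.+2)%:R / (len i.+1)%:R * (A * L).
    by ring.
  by rewrite -[leRHS]mulrA ler_wpM2r// mulr_ge0.
rewrite sumr_const card_ord -[_ *+ K]mulr_natr.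
have LL : L <= L ^+ 2 by rewrite expr2 ler_peMr.
have AL : A * L * K%:R <= A * L * L by rewrite ler_wpM2l// mulr_ge0.
rewrite expr2 in LL *; move: LL AL; move: (ln _) (K%:R) => u v; lra.
Qed.

End sample_path.

(** * Exceptional event and expected regret *)

Section regret.
Context (R : realType) (F : set (R -> R)) (Theta : set R) (dem : R -> R -> R).
Context (cstar c2 csg : R) (n : nat) (theta : R).
Hypothesis hF : standing_assumptions F.
Hypothesis h0 : zero_crossing Theta dem F cstar c2.
Hypothesis hcsg : 0 < csg.
Hypothesis L1 : 1 <= @ln R n%:R.
Hypothesis th : Theta theta.
Context disp (Omega : measurableType disp) (P : probability Omega R).
Variables (nu : R.-pker R ~> R) (X D : nat -> {mfun Omega >-> R}).
Hypothesis law : demand_law csg (dem theta) nu.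
Hypothesis run : policy_run P X D n (CM Theta dem c2 csg n) nu.
Local Notation L := (@ln R n%:R).
Local Notation len := (phase_len R n).
Local Notation pend := (phase_end R n).

Let X01 t w : (t < n)%N -> X t w \in `[0, 1].
Proof. by move=> tn; have [-> _] := run tn; rewrite /CM; exact: (CM_price01 csg n hF h0). Qed.

Variable dm : R -> R.
Hypothesis mdm : measurable_fun setT dm.
Hypothesis dmE : forall p, p \in `[0, 1] -> dm p = dem theta p.

Let bad j := [set w | ((len j.+1)%:R * (2 * csg * Num.sqrt (L / (len j.+1)%:R)) <=
  `|noise X D dm (pend j) (pend j.+1) w|)%R].

Let n_gt0 : 0 < n%:R :> R.
Proof. by rewrite ltNge; apply/negP => n0; move: L1; rewrite ln0// ler10. Qed.

(* Chernoff with l = sqrt(L / t) / csg: the two terms of the exponent are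
   t l^2 csg^2 = L and l u = 2 L. *)
Lemma phase_deviation_le j : (pend j.+1 <= n)%N -> (P (bad j) <= (2 / n%:R)%:E)%E.
Proof.
move=> jn; have len0 : 0 < (len j.+1)%:R :> R by rewrite ltr0n phase_len_gt0.
have L0 : 0 < L by exact: lt_le_trans L1.
set k : R := (len j.+1)%:R in len0 *; pose q := Num.sqrt (L / k).
have q2 : q ^+ 2 = L / k by rewrite sqr_sqrtr// divr_ge0// ltW.
have q0 : 0 < q by rewrite sqrtr_gt0 divr_gt0.
have lc : (q / csg) ^+ 2 * csg ^+ 2 = L / k by rewrite -exprMn divfK ?gt_eqF.
(* This is the range condition of the moment generating function bound, met because the phase has at
   least 9^(j+1) L rounds. *)
have Lk : L / k < 1.
  rewrite ltr_pdivrMr// mul1r; have /andP[lo _] := phase_len_bounds L1 j.+1.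
  apply: (lt_le_trans _ lo); rewrite ltr_pMl// exprn_egt1//.
  by rewrite (ltr_nat R 1 9).
have mean p : p \in `[0, 1] -> (\int[nu p]_y y%:E = (dm p)%:E)%E.
  by move=> p01; rewrite dmE//; have [] := law p01.
have sg p : p \in `[0, 1] -> (sg_norm (nu p) <= csg%:E)%E by move=> /law[].
have := @noise_deviation_le _ Omega R P X D nu n _ dm csg hcsg mdm run
  (fun t w tn => X01 w tn) mean sg (pend j) (len j.+1) (q / csg)
  (k * (2 * csg * q)); rewrite -phase_endS.
move=> /(_ jn (divr_gt0 q0 hcsg)); rewrite lc => /(_ Lk) /le_trans; apply.
rewrite -/k lee_fin ler_pM2l//.
have -> : k * (L / k) - q / csg * (k * (2 * csg * q)) = - L.
  rewrite (_ : q / csg * _ = 2 * k * q ^+ 2); last by field; rewrite gt_eqF.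
  by rewrite q2; field; rewrite gt_eqF.
by rewrite expRN lnK.
Qed.

Let K := completed_phases R n n.
Let B := \big[setU/set0]_(j < K) bad j.

Let mbad j : measurable (bad j).
Proof.
have mS : measurable_fun setT (fun w => `|noise X D dm (pend j) (pend j.+1) w|).
  by apply: measurableT_comp => //; exact: measurable_noise.
rewrite (_ : bad j = setT `&` (fun w => `|noise X D dm (pend j) (pend j.+1) w|) @^-1`
  `[(len j.+1)%:R * (2 * csg * Num.sqrt (L / (len j.+1)%:R)), +oo[).
  by apply: mS => //; exact: measurable_itv.
by rewrite setTI; apply/seteqP; split=> w /=; rewrite in_itv/= andbT.
Qed.

Let mB : measurable B. Proof. exact: bigsetU_measurable. Qed.

Lemma phases_deviation_le : (P B <= (2 * L / n%:R)%:E)%E.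
Proof.
apply: (@le_trans _ _ (\sum_(j < K) P (bad j))%E).
  by apply: le_mu_bigsetU => j _; exact: mbad.
apply: (@le_trans _ _ (\sum_(j < K) (2 / n%:R)%:E)%E).
  apply: lee_sum => j _; apply: phase_deviation_le.
  have /andP[Kn _] := completed_phasesP L1 n.
  by rewrite (leq_trans _ Kn)// phase_end_le.
rewrite sumEFin lee_fin sumr_const card_ord -[_ *+ K]mulr_natr mulrAC ler_pM2r ?invr_gt0//.
by rewrite ler_pM2l//; exact: completed_phases_le.
Qed.

Let ps := pstar (dem theta).

(** The expectation is not split over the exceptional event B: the inequality n r - A L^2 <= Z + n
    1_B holds at every outcome (on B because r <= 1 and Z >= 0) and is then integrated. *)
Lemma regret_le Q : 0 <= Q ->
  (forall p, p \in `[0, 1] ->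
    revenue (dem theta) ps - revenue (dem theta) p <= Q * (p - ps) ^+ 2) ->
  (regret P X n (dem theta) <=
    ((10 * (1 + Q * (64 * cstar ^+ 2 * c2 ^+ 2 * csg ^+ 2)) + 2) * L ^+ 2)%:E)%E.
Proof.
move=> Q0 quad; set A := 10 * _.
have L0 : 0 <= L by exact: le_trans L1.
have A0 : 0 <= A.
  have -> : A = 10 * (1 + Q * (64 * (cstar * c2 * csg) ^+ 2)) by rewrite /A; ring.
  by rewrite mulr_ge0// addr_ge0// mulr_ge0// mulr_ge0// sqr_ge0.
pose r := revenue (dem theta) ps.
pose Z w := \sum_(t < n) X t w * dem theta (X t w).
have ZE w : Z w = \sum_(t < n) X t w * dm (X t w).
  by apply: eq_bigr => t _; rewrite dmE ?X01.
have mZ : measurable_fun setT Z.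
  rewrite (funext ZE); apply: measurable_sum => t.
  by apply: measurable_funM => //; exact: measurableT_comp.
have Z0 w : 0 <= Z w.
  apply: sumr_ge0 => t _; have x01 := X01 w (ltn_ord t).
  have /andP[d0 _] := dem01 hF h0 th x01; rewrite mulr_ge0//.
  by move: x01; rewrite in_itv => /andP[].
have r1 : r <= 1.
  have ps01 := pstar01 hF h0 th; have /andP[d0 d1] := dem01 hF h0 th ps01.
  by move: ps01; rewrite in_itv/= => /andP[p0 p1]; rewrite mulr_ile1.
have good w : ~ B w -> n%:R * r - A * L ^+ 2 <= Z w.
  move=> nB; have noise_small j : (pend j.+1 <= n)%N ->
      `|\sum_(pend j <= s < pend j.+1) (D s w - dem theta (X s w))|
        < (len j.+1)%:R * (2 * csg * Num.sqrt (L / (len j.+1)%:R)).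
    move=> jn; rewrite ltNge; apply/negP => big; apply: nB.
    rewrite /B -bigcup_mkord; exists j => /=.
      rewrite ltnNge; apply/negP => Kj.
      have /andP[_] := completed_phasesP L1 n; rewrite ltnNge => /negP; apply.
      by apply: leq_trans jn; apply: phase_end_le.
    rewrite /bad/=; apply: (le_trans big); rewrite le_eqVlt; apply/orP; left.
    apply/eqP; congr `|_|; apply: eq_big_nat => s /andP[_ sj].
    by rewrite dmE//; exact: (X01 w (leq_trans sj jn)).
  have := path_regret_le hF h0 L1 th (fun t tn => (run tn).1 w) noise_small Q0 quad.
  by rewrite -/A sumrB sumr_const card_ord -/(Z w) -mulr_natl -/ps -/r; lra.
have mIB : measurable_fun setT (fun w => (n%:R * \1_B w)%:E : \bar R).
  by apply/measurable_EFinP; apply: measurable_funM => //; exact: measurable_indic.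
have EZ0 : (0 <= \int[P]_w (Z w)%:E)%E by apply: integral_ge0 => w _; rewrite lee_fin.
have intB : (\int[P]_w (n%:R * \1_B w)%:E <= (2 * L)%:E)%E.
  under eq_integral do rewrite EFinM.
  rewrite ge0_integralZl//; last exact/measurable_EFinP/measurable_indic.
  rewrite integral_indic// setIT.
  apply: (le_trans (lee_wpmul2l _ phases_deviation_le)); first by rewrite lee_fin ltW.
  by rewrite -EFinM lee_fin mulrC divfK ?gt_eqF.
have lower : ((n%:R * r - A * L ^+ 2)%:E <= \int[P]_w (Z w)%:E + (2 * L)%:E)%E.
  apply: (@le_trans _ _ (\int[P]_w (Z w)%:E + \int[P]_w (n%:R * \1_B w)%:E)%E); last exact: leeD2l.
  have ZE0 w : setT w -> (0 <= (Z w)%:E)%E by rewrite lee_fin.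
  have IE0 w : setT w -> (0 <= (n%:R * \1_B w)%:E :> \bar R)%E by rewrite lee_fin mulr_ge0.
  have mZE : measurable_fun setT (fun w => (Z w)%:E) by exact/measurable_EFinP.
  rewrite -(ge0_integralD P measurableT ZE0 mZE IE0 mIB).
  (* Truncation at 0 keeps the constant nonnegative, as the comparison of nonnegative integrals
     demands; the right side is nonnegative anyway. *)
  pose a := Num.max 0 (n%:R * r - A * L ^+ 2).
  apply: (@le_trans _ _ (\int[P]_w (cst a%:E) w)%E).
    by rewrite integral_cst// [X in (_ * X)%E](@probability_setT _ _ _ P) mule1 lee_fin le_max lexx orbT.
  apply: ge0_le_integral => //.
  - by move=> w _; rewrite lee_fin le_max lexx.
  - by apply: emeasurable_funD => //; exact/measurable_EFinP.
  move=> w _; rewrite -EFinD lee_fin ge_max; have Zw := Z0 w.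
  have IB : 0 <= n%:R * \1_B w :> R by rewrite mulr_ge0.
  rewrite addr_ge0//=; have [Bw|nBw] := pselect (B w); last first.
    by rewrite (le_trans (good w nBw))// lerDl.
  rewrite indicE mem_set// mulr1.
  have : n%:R * r <= n%:R * 1 by rewrite ler_pM2l.
  have : 0 <= A * L ^+ 2 by rewrite mulr_ge0// sqr_ge0.
  lra.
have LL : 2 * L <= 2 * L ^+ 2 by rewrite ler_pM2l// expr2 ler_peMr.
rewrite /regret (max_revenueE hF h0 th) -/r unlock.
move: EZ0 lower; rewrite -[X in (_ - X)%E]/(\int[P]_w (Z w)%:E)%E.
(* An infinite expected revenue would make the regret -oo, so its finiteness needs no separate
   argument. *)
case: (\int[P]_w (Z w)%:E)%E => [z| |]//= _; last by move=> _; rewrite leNye.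
rewrite -EFinD -EFinB !lee_fin [(A + 2) * _]mulrDl; move: (n%:R * r) (A * L ^+ 2) LL => u v; lra.
Qed.

End regret.

Theorem theorem2 (R : realType) (F : set (R -> R))
    (Theta : set R) (dem : R -> R -> R) (cstar c2 csg : R)
    (hF : standing_assumptions F)
    (h0 : zero_crossing Theta dem F cstar c2)
    (hcsg : 0 < csg) :
  exists C : R, \forall n \near \oo,
    forall (disp : measure_display) (Omega : measurableType disp)
      (nu : (R -> R) -> R.-pker R ~> R)
      (P : (R -> R) -> probability Omega R)
      (X D : nat -> {mfun Omega >-> R}),
    (forall d, F d -> demand_law csg d (nu d)) ->
    (forall d, F d -> policy_run (P d) X D n (CM Theta dem c2 csg n) (nu d)) ->
    (family_regret P X n F <= (C * ln n%:R ^+ 2)%:E)%E.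
Proof.
have [Q Q0 quad] := revenue_quadratic hF h0.
exists (10 * (1 + Q * (64 * cstar ^+ 2 * c2 ^+ 2 * csg ^+ 2)) + 2).
exists 3%N => // n /= n3 disp Omega nu P X D law run.
(* The threshold 3 comes from e <= 1 + 1 + 1^2, which is [expR_le_sqr] at 1. *)
have L1 : 1 <= @ln R n%:R.
  rewrite -[leLHS]expRK ler_ln ?posrE ?expR_gt0 ?ltr0n ?(leq_trans _ n3)//.
  apply: (le_trans (expR_le_sqr (lexx 1))).
  have : 3 <= n%:R :> R by rewrite (ler_nat R 3 n).
  by rewrite expr1n; lra.
apply: ge_ereal_sup => _ [d Fd <-].
have [_ _ surj] := param_bij h0; have [theta th dE] := surj d Fd.
have [dm mdm dmE] := dem_measurable h0 th.
move: (law d Fd) (run d Fd); rewrite -dE => law_d run_d.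
apply: (regret_le hF h0 hcsg L1 th law_d run_d mdm dmE Q0) => p p01.
exact: quad.
Qed.
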